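(* The following statements are true. 1) If $v\in(-1/2,1)$, then the global minimum of $T_v$ on $[0,1]$ equals $0$ and is attained only at the two points $0$ and $1$. 2) If $v=-1/2$, then the set of points of the global minimum of $T_v$ on $[0,1]$ has Hausdorff dimension $1/2$ and consists of all points having a binary expansion that is, after the binary point, an infinite concatenation of two-digit blocks each of which is either $00$ or $11$; that is, of all points having a base-$4$ expansion $0.y_1y_2\dots$ with $y_1,y_2,\dots\in\{0,3\}$. In this case $\min_{x\in[0,1]}T_v(x)=0$. 3) If $v\in(-1,-1/2)$, then $T_v$ attains its global minimum on $[0,1]$ at only the two points $1/5$ and $4/5$, and $\min_{x\in[0,1]}T_v(x)=T_v(1/5)=\dfrac{1+2v}{5(1-v^2)}$.
   Context: $T_0(x)$ is the distance from $x\in\mathbb R$ to the nearest integer, and for $v\in(-1,1)$, $T_v(x)=\sum_{n=0}^\infty v^nT_0(2^nx)$. *)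

(* Defs.v *)
From mathcomp Require Import all_boot all_order all_algebra.
From mathcomp Require Import all_classical all_reals all_analysis.
Import Order.TTheory GRing.Theory Num.Theory.
Import numFieldNormedType.Exports.

Set Implicit Arguments.
Unset Strict Implicit.
Unset Printing Implicit Defensive.

Local Open Scope classical_set_scope.
Local Open Scope ring_scope.

Definition dist_int (R : realType) (x : R) : R :=
  inf (range (fun k : int => `|x - k%:~R|)).

(* The series converges whenever |v| < 1; outside that range [limn] gives an
   unspecified value. *)
Definition takagi (R : realType) (v x : R) : R :=
  limn (series (fun n : nat => v ^+ n * dist_int (2 ^+ n * x))).

Definition is_minimum (R : realType) (f : R -> R) (A : set R) (m : R) : Prop :=
  (f @` A) m /\ lbound (f @` A) m.

Definition minimizers (R : realType) (f : R -> R) (A : set R) : set R :=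
  [set x | A x /\ forall y, A y -> f x <= f y].

(* [d n] is the (n+1)-st digit of x = 0.d_1 d_2 ... in base b.  Expansions need
   not be unique, and an expansion with all digits b - 1 represents 1. *)
Definition is_expansion (R : realType) (b : nat) (d : nat -> nat) (x : R) : Prop :=
  (forall n, (d n < b)%N) /\
  series (fun n : nat => (d n)%:R / b%:R ^+ n.+1) @ \oo --> x.

Definition diam (R : realType) (U : set R) : \bar R :=
  ereal_sup [set `|x - y|%:E | x in U & y in U].

(* The empty set is treated separately because [diam set0 = -oo].  For nonempty
   U, [0 `^ 0 = 1], so the 0-dimensional measure is the counting measure. *)
Definition diam_power (R : realType) (s : R) (U : set R) : \bar R :=
  if U == set0 then 0%E else (diam U `^ s)%E.

Definition hausdorff_content (R : realType) (s delta : R) (A : set R) : \bar R :=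
  ereal_inf [set (\sum_(0 <= i <oo) diam_power s (U i))%E | U in
    [set U : nat -> set R |
      A `<=` \bigcup_i U i /\ forall i, (diam (U i) <= delta%:E)%E]].

(* The contents increase as delta decreases to 0, so their limit is a supremum. *)
Definition hausdorff_measure (R : realType) (s : R) (A : set R) : \bar R :=
  ereal_sup [set hausdorff_content s delta A | delta in [set delta : R | 0 < delta]].

Definition hausdorff_dim (R : realType) (A : set R) : \bar R :=
  ereal_inf [set s%:E | s in [set s : R | 0 <= s /\ hausdorff_measure s A = 0%E]].

(* Main.v *)
(* Write T = T_v and T_0 for the distance to the nearest integer.  Iterating
   T(x) = T_0(x) + v T(2x) twice gives T(x) = h(x) + v^2 T(4x) with
   h(x) = T_0(x) + v T_0(2x), and by symmetry x may be taken in [0, 1/2].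

   For v >= -1/2, T_0(2x) <= 2 T_0(x) gives h >= 0, hence T >= 0; for v > -1/2, h
   vanishes only at the integers, while for v = -1/2 it vanishes exactly where
   T_0(x) <= 1/4, so that T(x) = 0 iff every 4^k x mod 1 lies in [0,1/4] or [3/4,1].

   For v < -1/2 the candidate value is c = T(1/5), and 4/5 = 1 - 1/5 makes 1/5 a fixed
   point of the folded map x -> 4x.  Left of 1/5, h(x) > h(1/5).  On [1/5, 1/4] a
   loss in h(x) is overcompensated by v^2 T(4x) = v^2 T(1 - 4x), as 1 - 4x <= 1/5.
   On [1/4, 1/2], reflecting x to 1/2 - x lowers T.  In all cases a bound T >= c - D
   improves to T >= c - v^2 D, so T >= c.

   The zero set for v = -1/2 has 2^n covering intervals of length 4^-n, so its dimension
   is at most 1/2.  Reading the digits 0, 3 as binary digits 0, 1 maps it onto [0,1], and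
   this map is Hoelder of exponent 1/2, so subadditivity of Lebesgue measure bounds
   the 1/2-content from below. *)
Require Import Defs.
From mathcomp Require Import all_boot all_order all_algebra.
From mathcomp Require Import all_classical all_reals all_analysis.
From mathcomp Require Import ring lra.
Import Order.TTheory GRing.Theory Num.Theory.
Import numFieldNormedType.Exports.
Set Implicit Arguments.
Unset Strict Implicit.
Unset Printing Implicit Defensive.
Local Open Scope classical_set_scope.
Local Open Scope ring_scope.

(** * The distance to the nearest integer *)

Lemma dist_int_min (R : realType) (x : R) (j : int) :
  (forall k : int, `|x - j%:~R| <= `|x - k%:~R|) -> dist_int x = `|x - j%:~R|.
Proof.
move=> jmin; apply/le_anti/andP; split.
  apply: ge_inf; last by exists j.
  by exists 0 => _ [k _ <-].
apply: lb_le_inf; first by exists `|x - j%:~R|, j.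
by move=> _ [k _ <-].
Qed.

Lemma dist_int_id (R : realType) (x : R) : 0 <= x <= 1 / 2 -> dist_int x = x.
Proof.
move=> xI; rewrite (@dist_int_min _ _ 0) subr0; first by rewrite ger0_norm; lra.
move=> k; rewrite ger0_norm; last by lra.
case: (lerP k 0) => [k0|].
  have : k%:~R <= 0 :> R by rewrite lerz0.
  by move=> ?; rewrite ger0_norm; lra.
rewrite gtz0_ge1 => k1.
have : 1 <= k%:~R :> R by rewrite ler1z.
by move=> ?; rewrite ler0_norm; lra.
Qed.

Lemma dist_intN (R : realType) (x : R) : dist_int (- x) = dist_int x.
Proof.
rewrite /dist_int; congr inf; apply/seteqP; split=> _ [k _ <-];
  by exists (- k) => //=; rewrite -normrN mulrNz; congr (`|_|); ring.
Qed.

Lemma dist_intDz (R : realType) (x : R) (j : int) :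
  dist_int (x + j%:~R) = dist_int x.
Proof.
rewrite /dist_int; congr inf; apply/seteqP; split=> _ [k _ <-].
  by exists (k - j) => //=; rewrite intrB; congr (`|_|); ring.
by exists (k + j) => //=; rewrite intrD; congr (`|_|); ring.
Qed.

(** Both [dist_int] and [takagi v] are even and 1-periodic, so this reduces claims about them to
    [0, 1/2], where [dist_int] is the identity. *)
Lemma dist_int_decomp (R : realType) (x : R) :
  exists (j : int) (s : R), 0 <= s <= 1 / 2 /\ (x = s + j%:~R \/ x = - s + j%:~R).
Proof.
have /andP[f1] := floor_itv x; rewrite intrD => f2.
case: (lerP (x - (Num.floor x)%:~R) (1 / 2)) => xf.
  by exists (Num.floor x), (x - (Num.floor x)%:~R); split; [lra|left; ring].
exists (Num.floor x + 1), ((Num.floor x)%:~R + 1 - x).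
by split; [lra|right; rewrite intrD; ring].
Qed.

Lemma dist_int_bound (R : realType) (x : R) : 0 <= dist_int x <= 1 / 2.
Proof.
have [j [s [sI [->|->]]]] := dist_int_decomp x; rewrite dist_intDz ?dist_intN;
  by rewrite dist_int_id.
Qed.

(** * Convergence, functional equation and symmetries of the series *)

Lemma takagi_term_le (R : realType) (v x : R) (n : nat) :
  `|v ^+ n * dist_int (2 ^+ n * x)| <= geometric 1 `|v| n.
Proof.
rewrite /= mul1r normrM normrX ler_piMr ?exprn_ge0//.
by have := dist_int_bound (2 ^+ n * x) => ?; rewrite ger0_norm; lra.
Qed.

Lemma is_cvg_normed_takagi (R : realType) (v x : R) : `|v| < 1 ->
  cvgn [normed series (fun n : nat => v ^+ n * dist_int (2 ^+ n * x))].
Proof.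
move=> v1; apply: (series_le_cvg _ _ (takagi_term_le v x)) => [n|n|] /=.
- exact: normr_ge0.
- by rewrite mul1r exprn_ge0.
- by apply: is_cvg_geometric_series; rewrite normr_id.
Qed.

Lemma is_cvg_takagi (R : realType) (v x : R) : `|v| < 1 ->
  cvgn (series (fun n : nat => v ^+ n * dist_int (2 ^+ n * x))).
Proof. by move=> v1; apply: normed_cvg; exact: is_cvg_normed_takagi. Qed.

Lemma takagi_rec (R : realType) (v x : R) : `|v| < 1 ->
  takagi v x = dist_int x + v * takagi v (2 * x).
Proof.
(* The limit is taken along n + 1, so that every partial sum has a first term to split off. *)
move=> v1; apply/cvg_lim => //; rewrite -cvg_shiftS /=.
rewrite [X in X @ _ --> _](_ : _ = (fun n => dist_int x +
     v * series (fun n : nat => v ^+ n * dist_int (2 ^+ n * (2 * x))) n)).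
  by apply: cvgD; [exact: cvg_cst|apply: cvgMr; exact: is_cvg_takagi].
apply/funext => n; rewrite /series /= big_nat_recl//= !expr0 !mul1r.
congr +%R; rewrite mulr_sumr; apply: eq_bigr => i _.
by rewrite exprS (exprSr 2) !mulrA.
Qed.

Lemma takagiN (R : realType) (v x : R) : takagi v (- x) = takagi v x.
Proof.
rewrite /takagi; congr (limn (series _)); apply/funext => n /=.
by rewrite (mulrN (2 ^+ n)) dist_intN.
Qed.

Lemma takagiDz (R : realType) (v x : R) (j : int) :
  takagi v (x + j%:~R) = takagi v x.
Proof.
rewrite /takagi; congr (limn (series _)); apply/funext => n /=.
have E : 2 ^+ n * j%:~R = (2 ^+ n * j)%:~R :> R by rewrite intrM rmorphXn.
by rewrite (mulrDr (2 ^+ n)) E dist_intDz.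
Qed.

Lemma takagi1B (R : realType) (v x : R) : takagi v (1 - x) = takagi v x.
Proof. by rewrite addrC (takagiDz _ _ 1) takagiN. Qed.

(** A crude uniform bound; it supplies the constant [B] that starts [ge_of_contraction]. *)
Lemma takagi_norm_le (R : realType) (v x : R) : `|v| < 1 ->
  `|takagi v x| <= 1 / (1 - `|v|).
Proof.
move=> v1; rewrite /takagi.
have /le_trans := lim_series_norm (is_cvg_normed_takagi (x := x) v1); apply.
have G : series (geometric 1 `|v|) @ \oo --> 1 / (1 - `|v|).
  by apply: cvg_geometric_series; rewrite normr_id.
rewrite -(cvg_lim _ G)//; apply: lim_series_le.
- exact: is_cvg_normed_takagi.
- by apply/cvg_ex; eexists; exact: G.
- exact: takagi_term_le.
Qed.

Lemma takagi_ge (R : realType) (v x : R) : `|v| < 1 ->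
  - (1 / (1 - `|v|)) <= takagi v x.
Proof. by move=> /(takagi_norm_le x); rewrite ler_norml => /andP[]. Qed.

Lemma takagi_reduce (R : realType) (v x : R) :
  exists2 s, 0 <= s <= 1 / 2 & takagi v x = takagi v s.
Proof.
have [j [s [sI [->|->]]]] := dist_int_decomp x; exists s => //;
  by rewrite takagiDz ?takagiN.
Qed.

(* If the gap below [c] always shrinks by the factor [q < 1], it is zero. *)
Lemma ge_of_contraction (R : realType) (T : Type) (f : T -> R) (B c q : R) :
  (forall x, B <= f x) -> 0 <= q < 1 ->
  (forall D, 0 <= D -> (forall x, c - D <= f x) -> forall x, c - q * D <= f x) ->
  forall x, c <= f x.
Proof.
move=> Bf /andP[q0 q1] H x.
(* The initial gap, clipped at 0 because [H] only accepts a nonnegative [D]. *)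
pose D0 := Num.max 0 (c - B).
have D00 : 0 <= D0 by rewrite le_max lexx.
have HD n : forall x, c - q ^+ n * D0 <= f x.
  elim: n => [y|n IH y].
    rewrite expr0 mul1r; apply: le_trans (Bf y).
    have : c - B <= D0 by rewrite le_max lexx orbT.
    lra.
  rewrite exprS -mulrA; apply: H => //; rewrite mulr_ge0 ?exprn_ge0//.
have : (fun n => c - q ^+ n * D0) @ \oo --> c.
  rewrite -[X in _ --> X]subr0 -[X in _ --> _ - X](mul0r D0).
  by apply: cvgB; [exact: cvg_cst|apply: cvgMl; apply: cvg_expr; rewrite ger0_norm].
move/(@cvgr_to_le _ _ _ _ _ _) => /(_ (f x)); apply; near=> n; exact: HD.
Unshelve. all: by end_near.
Qed.

(** * Minima, the fourfold recursion and the range v >= -1/2 *)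

Lemma is_minimumI (R : realType) (f : R -> R) (A : set R) (a m : R) :
  A a -> f a = m -> (forall x, A x -> m <= f x) -> is_minimum f A m.
Proof. by move=> Aa fa H; split; [exists a|move=> _ [x Ax <-]; exact: H]. Qed.

Lemma minimizersE (R : realType) (f : R -> R) (A : set R) (m : R) :
  is_minimum f A m -> minimizers f A = [set x | A x /\ f x = m].
Proof.
move=> [[a Aa fa] H]; apply/seteqP; split=> x [Ax Hx]; split=> //=.
  by apply/le_anti/andP; split; [rewrite -fa; exact: Hx|apply: H; exists x].
by move=> y Ay; rewrite Hx; apply: H; exists y.
Qed.

Lemma dist_int_double_le (R : realType) (s : R) : 0 <= s <= 1 / 2 ->
  dist_int (2 * s) <= 2 * s.
Proof.
move=> sI; have := dist_int_bound (2 * s).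
case: (lerP s (1 / 4)) => s4; last by lra.
by rewrite dist_int_id; lra.
Qed.

Lemma takagi_rec4 (R : realType) (v s : R) : `|v| < 1 -> 0 <= s <= 1 / 2 ->
  takagi v s = s + v * dist_int (2 * s) + v ^+ 2 * takagi v (4 * s).
Proof.
move=> v1 sI; rewrite takagi_rec// takagi_rec// dist_int_id//.
by rewrite mulrA (_ : 2 * 2 = 4 :> R); [ring|ring].
Qed.

(** Doubling sends s and 1/2 - s to 2s and 1 - 2s, where T agrees; only the first terms s and 1/2 -
    s differ. *)
Lemma takagi_fold_quarter (R : realType) (v s : R) : `|v| < 1 ->
  1 / 4 <= s <= 1 / 2 -> takagi v s = takagi v (1 / 2 - s) + (2 * s - 1 / 2).
Proof.
move=> v1 sI; rewrite takagi_rec// (takagi_rec (1 / 2 - s))// !dist_int_id; try lra.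
rewrite -(takagi1B v (2 * s)) (_ : 2 * (1 / 2 - s) = 1 - 2 * s); last by field.
by set t := takagi _ _; lra.
Qed.

Lemma takagi_low_quarter (R : realType) (v s : R) : `|v| < 1 ->
  0 <= s <= 1 / 4 -> takagi v s = (1 + 2 * v) * s + v ^+ 2 * takagi v (4 * s).
Proof. by move=> v1 sI; rewrite takagi_rec4 ?dist_int_id; try lra; ring. Qed.

Lemma takagi0 (R : realType) (v : R) : `|v| < 1 -> takagi v 0 = 0.
Proof.
move=> v1; have := takagi_rec 0 v1; rewrite mulr0 dist_int_id; last by lra.
move: v1; rewrite ltr_norml => v1 E.
have : (1 - v) * takagi v 0 = 0 by move: E; set t := takagi v 0; lra.
by move/eqP; rewrite mulf_eq0 => /orP[/eqP|/eqP//]; lra.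
Qed.

Lemma sqr_norm_lt1 (R : realType) (v : R) : `|v| < 1 -> 0 <= v ^+ 2 < 1.
Proof. by rewrite ltr_norml => v1; rewrite sqr_ge0/=; nra. Qed.

Lemma takagi_ge0 (R : realType) (v : R) : - (1 / 2) <= v < 1 ->
  forall x, 0 <= takagi v x.
Proof.
move=> vI; have v1 : `|v| < 1 by rewrite ltr_norml; lra.
apply: (ge_of_contraction (B := - (1 / (1 - `|v|))) (q := v ^+ 2)).
- by move=> x; exact: takagi_ge.
- exact: sqr_norm_lt1.
- move=> D D0 TD x; have [s sI ->] := takagi_reduce v x.
  rewrite takagi_rec4//.
  have := TD (4 * s); have := dist_int_bound (2 * s).
  have := dist_int_double_le sI; have := sqr_norm_lt1 v1.
  set u := dist_int _; set t := takagi _ _; set q := v ^+ 2 => Hq Hu ub Ht.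
  have : 0 <= q * (t + D) by apply: mulr_ge0; lra.
  have : 0 <= s + v * u by nra.
  by lra.
Qed.

(** Both summands of T(s) = h(s) + v^2 T(4s) are nonnegative, so h(s) = 0, whereas h(s) is at least
    s for v >= 0 and at least (1 + 2v)s for v <= 0. *)
Lemma takagi_eq0 (R : realType) (v s : R) : - (1 / 2) < v < 1 ->
  0 <= s <= 1 / 2 -> takagi v s = 0 -> s = 0.
Proof.
move=> vI sI; have v1 : `|v| < 1 by rewrite ltr_norml; lra.
rewrite takagi_rec4//.
have := @takagi_ge0 _ v ltac:(lra) (4 * s); have := dist_int_bound (2 * s).
have := dist_int_double_le sI; have := sqr_norm_lt1 v1.
set u := dist_int _; set t := takagi _ _; set q := v ^+ 2 => Hq Hu ub Ht E.
have : 0 <= q * t by apply: mulr_ge0; lra.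
have : 0 <= v -> 0 <= v * u by move=> ?; apply: mulr_ge0; lra.
have : v <= 0 -> v * (2 * s) <= v * u by move=> ?; nra.
case: (lerP v 0) => v0; last by move=> _ /(_ (ltW v0)); lra.
move=> /(_ isT) H1 _ H2; apply/eqP; case: (eqVneq s 0) => // s0.
have : 0 < s by rewrite lt_def s0; lra.
by nra.
Qed.

(** * The range v < -1/2 *)

Lemma norm_lt1_outside_half (R : realType) (v : R) :
  - 1 < v < - (1 / 2) -> `|v| < 1.
Proof. by move=> vI; rewrite ltr_norml; lra. Qed.

(** Since 4/5 = 1 - 1/5, the recursion at 1/5 closes on itself. The product form lets linear
    arithmetic use it without division. *)
Lemma takagi_fifth (R : realType) (v : R) : `|v| < 1 ->
  (1 - v ^+ 2) * takagi v (1 / 5) = (1 + 2 * v) / 5.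
Proof.
move=> v1; have := @takagi_low_quarter R v (1 / 5) v1.
rewrite (_ : 4 * (1 / 5) = 1 - 1 / 5); last by field.
rewrite takagi1B => /(_ ltac:(lra)).
by set t := takagi _ _; lra.
Qed.

(** Subtract the recursion at 1/5 from the one at s. The linear surplus is kept, as it pays for the
    loss right of 1/5 and later gives uniqueness. *)
Lemma takagi_left_fifth (R : realType) (v D s : R) : - 1 < v < - (1 / 2) ->
  (forall x, takagi v (1 / 5) - D <= takagi v x) ->
  0 <= s <= 1 / 5 ->
  takagi v (1 / 5) - (1 + 2 * v) * (1 / 5 - s) - v ^+ 2 * D <= takagi v s.
Proof.
move=> vI; have v1 := norm_lt1_outside_half vI; have := takagi_fifth v1.
set c := takagi v (1 / 5) => cE.
move=> TD sI; rewrite takagi_low_quarter//; last by lra.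
have := TD (4 * s); have q1 := sqr_norm_lt1 v1; move: cE.
set t := takagi v (4 * s); set q := v ^+ 2 in q1 *; move=> E Ht.
have : 0 <= q * (t - c + D) by apply: mulr_ge0; lra.
by lra.
Qed.

(** The left estimate at 1 - 4s has surplus -4(1 + 2v)(s - 1/5). Weighted by v^2 it outweighs the
    loss (1 + 2v)(s - 1/5), because 4v^2 > 1. *)
Lemma takagi_right_fifth (R : realType) (v D s : R) : - 1 < v < - (1 / 2) ->
  (forall x, takagi v (1 / 5) - D <= takagi v x) ->
  1 / 5 <= s <= 1 / 4 ->
  takagi v (1 / 5) - (1 + 2 * v) * (4 * v ^+ 2 - 1) * (s - 1 / 5) - v ^+ 4 * D
    <= takagi v s.
Proof.
move=> vI; have v1 := norm_lt1_outside_half vI; have := takagi_fifth v1.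
set c := takagi v (1 / 5) => cE.
move=> TD sI; rewrite takagi_low_quarter//; last by lra.
rewrite -(takagi1B v (4 * s)).
have := @takagi_left_fifth _ v D (1 - 4 * s) vI TD.
have q1 := sqr_norm_lt1 v1; move: cE.
rewrite (_ : v ^+ 4 = v ^+ 2 * v ^+ 2); last by ring.
rewrite -/c; set t := takagi v (1 - 4 * s); set q := v ^+ 2 in q1 *; move=> E Ht.
have {}Ht : 0 <= q * (t - (c - (1 + 2 * v) * (1 / 5 - (1 - 4 * s)) - q * D)).
  by apply: mulr_ge0; [lra|rewrite subr_ge0; apply: Ht; lra].
by lra.
Qed.

Lemma takagi_ge_fifth (R : realType) (v : R) : - 1 < v < - (1 / 2) ->
  forall x, takagi v (1 / 5) <= takagi v x.
Proof.
move=> vI; have v1 := norm_lt1_outside_half vI; have := takagi_fifth v1.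
set c := takagi v (1 / 5) => cE.
apply: (ge_of_contraction (B := - (1 / (1 - `|v|))) (q := v ^+ 2)).
- by move=> x; exact: takagi_ge.
- exact: sqr_norm_lt1.
- move=> D D0 TD x; have [s sI ->] := takagi_reduce v x.
  have q1 := sqr_norm_lt1 v1.
  have low r : 0 <= r <= 1 / 4 -> c - v ^+ 2 * D <= takagi v r.
    move=> rI; case: (lerP r (1 / 5)) => r5.
      apply: le_trans (@takagi_left_fifth _ v D r vI TD _); last by lra.
      have : 0 <= - (1 + 2 * v) * (1 / 5 - r) by apply: mulr_ge0; lra.
      by rewrite -/c; lra.
    apply: le_trans (@takagi_right_fifth _ v D r vI TD _); last by lra.
    have : 0 <= - (1 + 2 * v) * (4 * v ^+ 2 - 1) * (r - 1 / 5).
      by apply: mulr_ge0; [apply: mulr_ge0; nra|lra].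
    have : v ^+ 4 * D <= v ^+ 2 * D.
      apply: ler_wpM2r => //; rewrite (_ : v ^+ 4 = v ^+ 2 * v ^+ 2); last by ring.
      by rewrite ler_piMr; lra.
    by rewrite -/c; lra.
  (* Beyond 1/4 the fold to 1/2 - s lowers T by 2s - 1/2, so the bound on [0, 1/4] carries over. *)
  case: (lerP s (1 / 4)) => s4; first by apply: low; lra.
  have := low (1 / 2 - s); rewrite (takagi_fold_quarter (s := s))//; last by lra.
  by move=> /(_ ltac:(lra)); lra.
Qed.

(** As T(1/5) is a lower bound, the estimates hold with D = 0, and their surplus is strictly
    positive away from 1/5. Beyond 1/4, the folded point would fall below the minimum. *)
Lemma takagi_eq_fifth (R : realType) (v s : R) : - 1 < v < - (1 / 2) ->
  0 <= s <= 1 / 2 -> takagi v s = takagi v (1 / 5) -> s = 1 / 5.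
Proof.
move=> vI; have v1 := norm_lt1_outside_half vI; have := takagi_fifth v1.
set c := takagi v (1 / 5) => cE.
move=> sI E.
have TD x : c - 0 <= takagi v x by rewrite subr0; exact: takagi_ge_fifth.
case: (ltgtP s (1 / 5)) => // s5.
  have := @takagi_left_fifth _ v 0 s vI TD; rewrite E -/c => /(_ ltac:(lra)).
  have : 0 < - (1 + 2 * v) * (1 / 5 - s) by apply: mulr_gt0; lra.
  by lra.
case: (lerP s (1 / 4)) => s4.
  have := @takagi_right_fifth _ v 0 s vI TD; rewrite E -/c => /(_ ltac:(lra)).
  have : 0 < - (1 + 2 * v) * (4 * v ^+ 2 - 1) * (s - 1 / 5).
    by apply: mulr_gt0; [apply: mulr_gt0; nra|lra].
  by lra.
have := takagi_ge_fifth vI (1 / 2 - s); rewrite -/c.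
by have := @takagi_fold_quarter _ v s v1; rewrite E => /(_ ltac:(lra)); lra.
Qed.

(** Uniqueness on [0, 1/2] extends to [0, 1] by the symmetry x -> 1 - x. Used with s = 0 and s =
    1/5. *)
Lemma minimizers_takagi (R : realType) (v s m : R) :
  0 <= s <= 1 / 2 -> takagi v s = m -> (forall x, m <= takagi v x) ->
  (forall r, 0 <= r <= 1 / 2 -> takagi v r = m -> r = s) ->
  is_minimum (takagi v) `[0, 1] m /\
  minimizers (takagi v) `[0, 1] = [set s; 1 - s].
Proof.
move=> sI Ts Tm uniq_s.
have min : is_minimum (takagi v) `[0, 1] m.
  by apply: (is_minimumI (a := s)) => //=; rewrite in_itv/=; lra.
split=> //; rewrite (minimizersE min); apply/seteqP; split=> x /=.
  rewrite in_itv/= => -[xI Tx]; case: (lerP x (1 / 2)) => x2.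
    by left; apply: uniq_s => //; lra.
  right; have <- : 1 - x = s; last by ring.
  by apply: uniq_s; [lra|rewrite takagi1B].
by rewrite in_itv/= => -[->|->]; rewrite ?takagi1B; split=> //; lra.
Qed.

(** * Digit expansions and the base-4 Cantor set *)

(* [z n] is the number whose expansion is the [n]-fold shift of the digits [d]. *)
Definition digit_orbit (R : realType) (b : nat) (d : nat -> nat) (z : nat -> R) :=
  forall n, 0 <= z n <= 1 /\ b%:R * z n = (d n)%:R + z n.+1.

(** The partial sums satisfy p_n <= x <= p_n + b^-n, so the rescaled remainders b^n (x - p_n) stay
    in [0, 1] and form the orbit. *)
Lemma is_expansion_orbit (R : realType) (b : nat) (d : nat -> nat) (x : R) :
  (1 < b)%N -> is_expansion b d x -> exists2 z, z 0%N = x & digit_orbit b d z.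
Proof.
move=> b1 [db px].
have b0 : (0 : R) < b%:R by rewrite ltr0n ltnW.
set p := series _ in px.
have pS n : p n.+1 = p n + (d n)%:R / b%:R ^+ n.+1 by rewrite /p seriesSr.
have bX n : (0 : R) < b%:R ^+ n by rewrite exprn_gt0.
have p_le n : p n <= x.
  rewrite -(cvg_lim _ px)//; apply: nondecreasing_cvgn_le; last by apply/cvg_ex; exists x.
  by apply/nondecreasing_seqP => m; rewrite pS lerDl divr_ge0// ltW.
(* The upper bounds [q] do not increase because each digit is at most b - 1. *)
pose q n := p n + 1 / b%:R ^+ n.
have qx : q @ \oo --> x.
  rewrite -[X in _ --> X]addr0; apply: cvgD => //.
  rewrite (_ : (fun _ => _) = (GRing.exp (b%:R^-1 : R))).
    by apply: cvg_expr; rewrite ger0_norm ?invr_ge0 ?ltW// invf_lt1// ltr1n.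
  by apply/funext => n; rewrite exprVn mul1r.
have x_le n : x <= q n.
  rewrite -(cvg_lim _ qx)//; apply: nonincreasing_cvgn_ge; last by apply/cvg_ex; exists x.
  apply/nonincreasing_seqP => m; rewrite /q pS -addrA lerD2l -mulrDl.
  rewrite ler_pdivrMr// exprSr mul1r mulrA mulVf ?gt_eqF// mul1r.
  by rewrite natr1 ler_nat.
exists (fun n => b%:R ^+ n * (x - p n)).
  by rewrite expr0 mul1r /p /series/= big_geq// subr0.
move=> n; split.
  have := p_le n; have := x_le n; rewrite /q => h1 h2.
  apply/andP; split; first by rewrite mulr_ge0 ?subr_ge0// ltW.
  by rewrite mulrC -ler_pdivlMr//; lra.
rewrite pS exprS; field.
by rewrite gt_eqF//= ?gt_eqF.
Qed.

(** The orbit relation telescopes to p_n = z_0 - z_n b^-n, and z_n is bounded. *)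
Lemma orbit_is_expansion (R : realType) (b : nat) (d : nat -> nat) (z : nat -> R) :
  (1 < b)%N -> (forall n, (d n < b)%N) -> digit_orbit b d z -> is_expansion b d (z 0%N).
Proof.
move=> b1 db dz; split=> //.
have b0 : (0 : R) < b%:R by rewrite ltr0n ltnW.
have bX n : (0 : R) < b%:R ^+ n by rewrite exprn_gt0.
set p := series _.
have pE : p = fun n => z 0%N - z n * (b%:R^-1) ^+ n.
  apply/funext; elim=> [|n IH].
    by rewrite /p /series/= big_geq// expr0 mulr1 subrr.
  rewrite /p seriesSr -/p IH.
  have [_ E] := dz n; have -> : (d n)%:R = b%:R * z n - z n.+1 by rewrite E addrK.
  rewrite !exprVn exprS; field.
  by rewrite gt_eqF//= ?gt_eqF.
rewrite pE -[X in _ --> X]subr0; apply: cvgB; first exact: cvg_cst.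
apply: (@squeeze_cvgr _ _ _ _ (fun=> 0) (GRing.exp (b%:R^-1 : R))).
- near=> n; have [zn _] := dz n.
  have : 0 <= b%:R^-1 ^+ n :> R by rewrite exprn_ge0 ?invr_ge0 ?ltW.
  by move=> ?; apply/andP; split; nra.
- exact: cvg_cst.
- by apply: cvg_expr; rewrite ger0_norm ?invr_ge0 ?ltW// invf_lt1// ltr1n.
Unshelve. all: by end_near.
Qed.

(** Encoded by bits and a shift orbit: the functional equation acts along [z], and the same bits [e]
    can be reread in base 2. *)
Definition base4_cantor (R : realType) : set R :=
  [set x | exists (e : nat -> bool) (z : nat -> R),
     z 0%N = x /\ digit_orbit 4 (fun n => 3 * e n)%N z].
Arguments base4_cantor R : clear implicits.

Lemma base4_cantor_expansion4 (R : realType) :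
  base4_cantor R = [set x | exists y : nat -> nat, is_expansion 4 y x /\
              forall k : nat, y k = 0%N \/ y k = 3%N].
Proof.
apply/seteqP; split=> x.
  move=> [e [z [<- ez]]]; exists (fun n => 3 * e n)%N; split.
    by apply: orbit_is_expansion => // n; case: (e n).
  by move=> k; case: (e k); [right|left].
move=> [y [/is_expansion_orbit[//|z zx yz] y03]].
exists (fun n => y n == 3%N), z; split=> // n; have [zn ->] := yz n.
by split=> //; case: (y03 n) => ->.
Qed.

Lemma base4_cantor_expansion2 (R : realType) :
  base4_cantor R = [set x | exists d : nat -> nat, is_expansion 2 d x /\
              forall k : nat, (d k.*2 = 0%N /\ d k.*2.+1 = 0%N) \/
                              (d k.*2 = 1%N /\ d k.*2.+1 = 1%N)].
Proof.
apply/seteqP; split=> x.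
  move=> [e [z [<- ez]]].
  exists (fun n => nat_of_bool (e n./2)); split; last first.
    by move=> k /=; rewrite uphalf_double doubleK; case: (e k); [right|left].
  (* The binary orbit: a base-4 digit 3e is the block ee, and dropping only its first bit leaves 2
     z_k - e_k = (e_k + z_(k+1)) / 2. *)
  pose w n := if odd n then ((e n./2)%:R + z n./2.+1) / 2 else z n./2.
  rewrite -[z 0%N]/(w 0%N); apply: orbit_is_expansion => // [n|n]; first by case: (e _).
  have [zn E] := ez n./2; have [zn1 _] := ez n./2.+1.
  rewrite /w /= uphalf_half; case: (boolP (odd n)) => on /=.
    by split; [case: (e n./2) => /=; lra|rewrite add1n; field].
  by rewrite add0n; split=> //; move: E; rewrite natrM; lra.
move=> [d [/is_expansion_orbit[//|z zx dz] d01]].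
exists (fun n => d n.*2 == 1%N), (fun n => z n.*2); split=> // n.
have [z0 E0] := dz n.*2; have [z1 E1] := dz n.*2.+1.
rewrite doubleS natrM; split=> //.
by case: (d01 n) => -[D0 D1]; rewrite D0 D1 /= in E0 E1 *; lra.
Qed.

(** * The zero set for v = -1/2 *)

(** Beyond 1/4 the fold adds 2s - 1/2 > 0 to a nonnegative value. Up to 1/4 the coefficient 1 + 2v
    vanishes, leaving T(s) = T(4s) / 4. *)
Lemma takagi_half_eq0_low (R : realType) (s : R) : 0 <= s <= 1 / 2 ->
  takagi (- (1 / 2)) s = 0 -> s <= 1 / 4 /\ takagi (- (1 / 2)) (4 * s) = 0.
Proof.
move=> sI; have v1 : `|- (1 / 2) : R| < 1 by rewrite ltr_norml; lra.
case: (lerP s (1 / 4)) => s4.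
  by rewrite takagi_low_quarter//; [set t := takagi _ _; lra|lra].
have := @takagi_ge0 _ (- (1 / 2) : R) ltac:(lra) (1 / 2 - s).
by rewrite (takagi_fold_quarter (s := s))//; [set t := takagi _ _; lra|lra].
Qed.

(** One base-4 shift, with digit 0 on the lower half and 3 on the upper half; the latter reduces to
    the former by x -> 1 - x. *)
Lemma takagi_half_eq0_step (R : realType) (x : R) (y := 4 * x - (3 * (1 / 2 < x)%R)%:R) :
  0 <= x <= 1 -> takagi (- (1 / 2)) x = 0 ->
  0 <= y <= 1 /\ takagi (- (1 / 2)) y = 0.
Proof.
move=> xI; rewrite {}/y; case: (lerP x (1 / 2)) => x2.
  by move=> /takagi_half_eq0_low[|x4 T4]; rewrite ?muln0 ?subr0; lra.
rewrite -takagi1B => /takagi_half_eq0_low[|x4 T4]; first by lra.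
rewrite muln1 -takagi1B (_ : 1 - (4 * x - 3) = 4 * (1 - x)); last by ring.
by split=> //; lra.
Qed.

Lemma takagi_half_orbit (R : realType) (e : bool) (x y : R) :
  0 <= x <= 1 -> 0 <= y <= 1 -> 4 * x = (3 * e)%:R + y ->
  takagi (- (1 / 2)) x = 1 / 4 * takagi (- (1 / 2)) y.
Proof.
move=> xI yI; have v1 : `|- (1 / 2) : R| < 1 by rewrite ltr_norml; lra.
case: e => /= E.
  rewrite -takagi1B takagi_low_quarter//; last by lra.
  rewrite (_ : 4 * (1 - x) = 1 - y); last by lra.
  by rewrite takagi1B; field.
rewrite takagi_low_quarter//; last by lra.
by rewrite (_ : 4 * x = y); [field|lra].
Qed.

Lemma takagi_half_eq0 (R : realType) :
  [set x : R | 0 <= x <= 1 /\ takagi (- (1 / 2)) x = 0] = base4_cantor R.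
Proof.
apply/seteqP; split=> x.
  move=> [xI Tx].
  pose step (y : R) := 4 * y - (3 * (1 / 2 < y)%R)%:R.
  have it n : 0 <= iter n step x <= 1 /\ takagi (- (1 / 2)) (iter n step x) = 0.
    by elim: n => //= n [zn Tz]; exact: takagi_half_eq0_step.
  exists (fun n => (1 / 2 < iter n step x)%R), (fun n => iter n step x).
  split=> // n; have [zn _] := it n; split=> //=.
  by rewrite /step addrC subrK.
move=> [e [z [<- ez]]]; have [z0 _] := ez 0%N; split=> //.
have v1 : `|- (1 / 2) : R| < 1 by rewrite ltr_norml; lra.
apply/le_anti/andP; split; last by apply: takagi_ge0; lra.
(* The contraction runs over the orbit index: each shift scales T by 1/4, and T is bounded, so -T >=
   0 along the whole orbit. *)
rewrite -oppr_ge0; suff : forall n, 0 <= - takagi (- (1 / 2)) (z n) by apply.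
apply: (ge_of_contraction (B := - (1 / (1 - `|- (1 / 2)|))) (q := 1 / 4)).
- by move=> n; rewrite lerN2; move: (takagi_norm_le (z n) v1); rewrite ler_norml => /andP[].
- by lra.
- move=> D _ HD n; have [zn E] := ez n; have [zn1 _] := ez n.+1.
  by have := HD n.+1; rewrite (takagi_half_orbit zn zn1 E); lra.
Qed.

(** * The Cantor function and its Hoelder bound *)

Lemma digit_orbit_exists (R : realType) (b : nat) (d : nat -> nat) :
  (1 < b)%N -> (forall n, (d n < b)%N) -> exists z : nat -> R, digit_orbit b d z.
Proof.
move=> b1 db; have b0 : (0 : R) < b%:R by rewrite ltr0n ltnW.
have : cvgn (series (fun n : nat => (d n)%:R / b%:R ^+ n.+1 : R)).
  apply: (@series_le_cvg _ _ (geometric 1 (b%:R^-1))) => [n|n|n|] /=.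
  - by rewrite divr_ge0// exprn_ge0// ltW.
  - by rewrite mul1r exprn_ge0// invr_ge0 ltW.
  - rewrite mul1r exprVn exprS invfM mulrA ler_piMl ?invr_ge0 ?exprn_ge0 ?ltW//.
    by rewrite ltr_pdivrMr// mul1r ltr_nat.
  - by apply: is_cvg_geometric_series; rewrite ger0_norm ?invr_ge0 ?ltW// invf_lt1// ltr1n.
move=> /cvg_ex[x dx].
have [|z _ dz] := @is_expansion_orbit R b d x b1; first by split.
by exists z.
Qed.

Lemma binary_orbit_exists (R : realType) (t : R) : 0 <= t <= 1 ->
  exists (e : nat -> bool) (w : nat -> R), w 0%N = t /\ digit_orbit 2 e w.
Proof.
(* Digit 1 is chosen only above 1/2, so 1/2 moves to 1, which is fixed with all digits 1; the
   iterates never leave [0, 1]. *)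
move=> tI; pose step (y : R) := 2 * y - (1 / 2 < y)%R%:R.
have it n : 0 <= iter n step t <= 1.
  elim: n => //= n; move: (iter n step t) => y.
  by rewrite /step; case: (lerP y (1 / 2)) => /=; lra.
exists (fun n => (1 / 2 < iter n step t)%R), (fun n => iter n step t).
by split=> // n; split=> //=; rewrite /step addrC subrK.
Qed.

(* The graph of the Cantor function on the base-4 Cantor set. *)
Definition same_bits (R : realType) (x t : R) :=
  exists (e : nat -> bool) (z w : nat -> R),
    [/\ z 0%N = x, w 0%N = t, digit_orbit 4 (fun n => 3 * e n)%N z & digit_orbit 2 e w].

(** While the bits agree, a shift scales both sides by the same factor 4. At the first disagreement
    the points of the Cantor set are at least 1/2 apart and the binary values at most 1. *)
Lemma same_bits_holder (R : realType) (x x' t t' : R) :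
  same_bits x t -> same_bits x' t' -> (t - t') ^+ 2 <= 2 * `|x - x'|.
Proof.
move=> [e [z [w [<- <- ez ew]]]] [e' [z' [w' [<- <- ez' ew']]]].
(* The error 4^-n absorbs the case of n agreeing bits; quantifying over k lets the induction pass to
   the shifted orbits. *)
have H n : forall k, (w k - w' k) ^+ 2 <= 2 * `|z k - z' k| + 4^-1 ^+ n.
  elim: n => [|n IH] k.
    have [? _] := ew k; have [? _] := ew' k; have := normr_ge0 (z k - z' k).
    by rewrite expr0; nra.
  have := IH k.+1; rewrite (exprS _ n).
  have [w0 /= Ew] := ew k; have [w0' /= Ew'] := ew' k.
  have [w1 _] := ew k.+1; have [w1' _] := ew' k.+1.
  have [z0 /= Ez] := ez k; have [z0' /= Ez'] := ez' k.
  have [z1 _] := ez k.+1; have [z1' _] := ez' k.+1.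
  have : 0 <= 4^-1 ^+ n :> R by rewrite exprn_ge0.
  set q := 4^-1 ^+ n => q0.
  case: (eqVneq (e k) (e' k)) => ee.
    have -> : w k - w' k = 1 / 2 * (w k.+1 - w' k.+1)
      by move: Ew Ew'; rewrite ee; case: (e' k) => /=; lra.
    have -> : z k - z' k = 1 / 4 * (z k.+1 - z' k.+1)
      by move: Ez Ez'; rewrite ee; case: (e' k) => /=; lra.
    by rewrite normrM (@ger0_norm _ (1 / 4))//; lra.
  move=> _; have : 1 / 2 <= `|z k - z' k|.
    move: ee Ez Ez'; rewrite ler_normr.
    case: (e k); case: (e' k) => //= _ Ez Ez'; apply/orP; first by left; lra.
    by right; lra.
  by nra.
have : (fun n => 2 * `|z 0%N - z' 0%N| + 4^-1 ^+ n) @ \oo --> 2 * `|z 0%N - z' 0%N|.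
  rewrite -[X in _ --> X]addr0; apply: cvgD; first exact: cvg_cst.
  by apply: cvg_expr; rewrite ger0_norm//; lra.
move/(@cvgr_to_ge _ _ _ _ _ _) => /(_ ((w 0%N - w' 0%N) ^+ 2)); apply.
by near=> n; exact: H.
Unshelve. all: by end_near.
Qed.

Lemma same_bits_surj (R : realType) (t : R) : 0 <= t <= 1 ->
  exists2 x, base4_cantor R x & same_bits x t.
Proof.
move=> /binary_orbit_exists[e [w [wt ew]]].
have [|z ez] := @digit_orbit_exists R 4 (fun n => 3 * e n)%N isT.
  by move=> n; case: (e n).
by exists (z 0%N); [exists e, z|exists e, z, w].
Qed.

Lemma same_bits_itv (R : realType) (x t : R) : same_bits x t -> 0 <= t <= 1.
Proof. by move=> [e [z [w [_ <- _ ew]]]]; have [] := ew 0%N. Qed.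

(** * Coverings and the upper bound for the dimension *)

Fixpoint cantor_left_endpoints (R : realType) (n : nat) : seq R :=
  if n is m.+1 then
    [seq x / 4 | x <- cantor_left_endpoints R m] ++
    [seq (x + 3) / 4 | x <- cantor_left_endpoints R m]
  else [:: 0].

Lemma size_cantor_left_endpoints (R : realType) (n : nat) :
  size (cantor_left_endpoints R n) = (2 ^ n)%N.
Proof.
by elim: n => //= n IH; rewrite size_cat !size_map IH addnn -mul2n expnS.
Qed.

(** Dropping the first digit gives a point covered at the previous level; the branch x/4 or (x +
    3)/4 named by that digit maps its interval back. *)
Lemma cantor_left_endpoints_cover (R : realType) (n : nat) (x : R) :
  base4_cantor R x ->
  exists2 p, p \in cantor_left_endpoints R n & p <= x <= p + 4^-1 ^+ n.
Proof.
elim: n x => [|n IH] x [e [z [<- ez]]].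
  by have [z0 _] := ez 0%N; exists 0; rewrite ?inE//; lra.
have [] := IH (z 1%N).
  by exists (fun n => e n.+1), (fun n => z n.+1); split=> // k; exact: ez.
have [_] := ez 0%N; case: (e 0%N) => /= E p pn pz; rewrite exprS.
  exists ((p + 3) / 4); last by lra.
  by rewrite mem_cat; apply/orP; right; exact: (map_f (fun y => (y + 3) / 4)).
exists (p / 4); last by lra.
by rewrite mem_cat; apply/orP; left; exact: (map_f (fun y => y / 4)).
Qed.

Lemma diam_le (R : realType) (U : set R) (r : R) :
  (forall x y, U x -> U y -> `|x - y| <= r) -> (diam U <= r%:E)%E.
Proof. by move=> H; apply: ge_ereal_sup => _ [x Ux [y Uy <-]]; rewrite lee_fin H. Qed.

Lemma le_diam (R : realType) (U : set R) (x y : R) :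
  U x -> U y -> (`|x - y|%:E <= diam U)%E.
Proof. by move=> Ux Uy; apply: ereal_sup_ubound; exists x => //; exists y. Qed.

Lemma diam_ge0 (R : realType) (U : set R) : U !=set0 -> (0 <= diam U)%E.
Proof. by move=> [x Ux]; have := le_diam Ux Ux; rewrite subrr normr0. Qed.

Lemma diam_power_ge0 (R : realType) (s : R) (U : set R) : (0 <= diam_power s U)%E.
Proof. by rewrite /diam_power; case: eqP => // _; exact: poweR_ge0. Qed.

Lemma diam_power_le (R : realType) (s : R) (U : set R) (r : R) :
  0 <= s -> (forall x y, U x -> U y -> `|x - y| <= r) ->
  (diam_power s U <= (r `^ s)%:E)%E.
Proof.
move=> s0 Ur; rewrite /diam_power; case: eqP => [_|/eqP/set0P U0].
  by rewrite lee_fin powR_ge0.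
have d0 := diam_ge0 U0; have dr := diam_le Ur.
rewrite -poweR_EFin; apply: gt0_ler_poweR => //;
  by rewrite in_itv/= leey andbT// (le_trans d0).
Qed.

Lemma hausdorff_content_ge0 (R : realType) (s delta : R) (A : set R) :
  (0 <= hausdorff_content s delta A)%E.
Proof.
apply: le_ereal_inf_tmp => _ [U _ <-].
by apply: nneseries_ge0 => n _ _; exact: diam_power_ge0.
Qed.

Lemma hausdorff_content_finite_cover (R : realType) (s delta : R) (A : set R)
    (U : nat -> set R) (N : nat) (r : R) :
  0 <= s -> r <= delta ->
  (forall i x y, U i x -> U i y -> `|x - y| <= r) ->
  (forall x, A x -> exists2 i, (i < N)%N & U i x) ->
  (hausdorff_content s delta A <= (N%:R * r `^ s)%:E)%E.
Proof.
(* The finite cover is padded with empty sets, which cost 0 even when s = 0. *)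
move=> s0 rd Ur AU; pose V i := if (i < N)%N then U i else set0.
have Vr i x y : V i x -> V i y -> `|x - y| <= r.
  by rewrite /V; case: ifP => // _; exact: Ur.
apply: (@le_trans _ _ (\sum_(0 <= i <oo) diam_power s (V i))%E).
  apply: ereal_inf_lbound; exists V => //; split=> [x /AU[i iN Ux]|i].
    by exists i => //; rewrite /V iN.
  by apply: le_trans (diam_le (Vr i)) _; rewrite lee_fin.
rewrite (nneseries_split 0 N); last by move=> k _; exact: diam_power_ge0.
rewrite add0n [X in (_ + X)%E]eseries0 ?adde0; last first.
  by move=> i Ni _; rewrite /V ltnNge Ni/= /diam_power eqxx.
apply: (@le_trans _ _ (\sum_(0 <= i < N) (r `^ s)%:E)%E).
  by apply: lee_sum => i _; exact: diam_power_le (Vr i).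
by rewrite sumEFin lee_fin sumr_const_nat subn0 mulr_natl.
Qed.

(** The 2^n intervals of length 4^-n cost (2 * 4^-s)^n, which tends to 0 because 4^-s < 1/2. *)
Lemma hausdorff_measure_cantor_gt (R : realType) (s : R) : 1 / 2 < s ->
  hausdorff_measure s (base4_cantor R) = 0%E.
Proof.
move=> s2; have s0 : 0 <= s by lra.
have content0 delta : 0 < delta -> hausdorff_content s delta (base4_cantor R) = 0%E.
  move=> delta0; apply/eqP; rewrite eq_le hausdorff_content_ge0 andbT.
  pose q : R := 2 * 4^-1 `^ s.
  have q0 : 0 <= q by rewrite mulr_ge0 ?powR_ge0.
  have q1 : q < 1.
    have E : 4^-1 `^ s = 2^-1 * 2^-1 `^ (2 * s - 1) :> R.
      rewrite mulr_powRB1 ?invr_ge0//; last by lra.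
      by rewrite powRrM powR_mulrn ?invr_ge0// exprVn -natrX.
    have : 2^-1 `^ (2 * s - 1) < 1 :> R.
      have := @gt0_ltr_powR R (2 * s - 1) ltac:(lra) 2^-1 1; rewrite powR1.
      by apply; rewrite ?nnegrE; lra.
    by rewrite /q E; lra.
  have bound n : 4^-1 ^+ n <= delta ->
      (hausdorff_content s delta (base4_cantor R) <= (q ^+ n)%:E)%E.
    move=> nd; pose p i := nth 0 (cantor_left_endpoints R n) i.
    have -> : q ^+ n = (2 ^ n)%:R * (4^-1 ^+ n) `^ s.
      rewrite /q exprMn natrX; congr *%R.
      by rewrite -[in RHS]powR_mulrn// -powRrM mulrC powRrM powR_mulrn ?powR_ge0.
    apply: (@hausdorff_content_finite_cover _ _ _ _
              (fun i => [set x | p i <= x <= p i + 4^-1 ^+ n])) => //.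
      by move=> i x y /= xi yi; rewrite ler_norml; lra.
    move=> x /(cantor_left_endpoints_cover n)[y yn yx].
    exists (index y (cantor_left_endpoints R n)).
      by rewrite -(size_cantor_left_endpoints R) index_mem.
    by rewrite /= /p nth_index.
  apply/lee_addgt0Pr => eps eps0; rewrite add0e.
  near \oo => n; apply: (@le_trans _ _ (q ^+ n)%:E).
    apply: bound; near: n; apply: (cvgr_le _ (cvg_expr _)) => //.
    by rewrite ger0_norm; lra.
  by rewrite lee_fin; near: n; apply: (cvgr_le _ (cvg_expr _)) => //; rewrite ger0_norm.
apply/eqP; rewrite eq_le; apply/andP; split.
  by apply: ge_ereal_sup => _ [delta d0 <-]; rewrite content0.
by apply: ereal_sup_ubound; exists 1; [exact: ltr01|rewrite content0].
Unshelve. all: by end_near.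
Qed.

(** * The lower bound for the dimension *)

(** With d the diameter, |t - t'|^2 <= 2d <= 4 d^(2s), where the last step uses d <= 1 and 2s <=
    1. *)
Lemma dist_le_diam_power (R : realType) (s : R) (U : set R) (x x' t t' : R) :
  0 <= s <= 1 / 2 -> (diam U <= 1%:E)%E -> U x -> U x' ->
  same_bits x t -> same_bits x' t' -> (`|t - t'|%:E <= 2%:E * diam_power s U)%E.
Proof.
move=> sI U1 Ux Ux' xt xt'; rewrite /diam_power.
have U0 : U !=set0 by exists x.
have -> : (U == set0) = false by apply/negbTE/set0P.
have d0 := diam_ge0 U0; have dx := le_diam Ux Ux'.
have dE : diam U = (fine (diam U))%:E.
  by rewrite fineK// ge0_fin_numE// (le_lt_trans U1)// ltry.
move: U1 d0 dx; rewrite dE poweR_EFin -EFinM !lee_fin.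
set d := fine _ => d1 d0 dx; set u := d `^ s.
have u0 : 0 <= u by exact: powR_ge0.
have du : d <= u ^+ 2.
  rewrite -powR_mulrn// -powRrM; case: (eqVneq d 0) => [->|dn0]; first exact: powR_ge0.
  by apply: ger1_powR; [rewrite lt_def dn0 d0|lra].
have h := same_bits_holder xt xt'.
rewrite -(ler_pXn2r (n := 2))// ?nnegrE ?mulr_ge0//.
by rewrite -normrX ger0_norm ?sqr_ge0// exprMn; nra.
Qed.

(** The image of U under the Cantor function has diameter at most 2 diam(U)^s, so an interval of
    that length starting at its infimum contains it. *)
Lemma same_bits_cover_itv (R : realType) (s : R) (U : set R) :
  0 <= s <= 1 / 2 -> (diam U <= 1%:E)%E ->
  exists J : interval R, (lebesgue_measure [set` J] <= 2%:E * diam_power s U)%E /\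
    forall x t, U x -> same_bits x t -> t \in J.
Proof.
move=> sI U1.
case: (pselect (exists x t, U x /\ same_bits x t)) => [[x0 [t0 [Ux0 xt0]]]|nU]; last first.
  (* An empty image is treated apart, as its infimum carries no information. *)
  exists `]0, 0[%R; split; last by move=> x t Ux xt; case: nU; exists x, t.
  by rewrite lebesgue_measure_itv/= ltxx mule_ge0// diam_power_ge0.
have P0 := diam_power_ge0 s U.
have PE : diam_power s U = (fine (diam_power s U))%:E.
  rewrite fineK// ge0_fin_numE// /diam_power; case: ifP => // _.
  by rewrite poweR_lty// (le_lt_trans U1)// ltry.
pose V := [set t | exists2 x, U x & same_bits x t].
have Vlb : has_lbound V by exists 0 => t [x _ /same_bits_itv/andP[]].
set r := 2 * fine (diam_power s U).
have rE : (2%:E * diam_power s U)%E = r%:E by rewrite PE.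
have r0 : 0 <= r by rewrite -lee_fin -rE mule_ge0.
exists `[inf V, inf V + r]; split.
  rewrite rE lebesgue_measure_itv/= lte_fin; case: ifP => // _.
  by rewrite -EFinB lee_fin; lra.
move=> x t Ux xt; rewrite in_itv/=; apply/andP; split.
  by apply: ge_inf => //; exists x.
rewrite -lerBlDr; apply: lb_le_inf; first by exists t, x.
move=> t' [x' Ux' xt']; have := dist_le_diam_power sI U1 Ux Ux' xt xt'.
by rewrite rE lee_fin ler_norml; lra.
Qed.

(** The image intervals of a cover of the Cantor set cover [0, 1], so their total length, at most
    twice the cost of the cover, is at least 1. *)
Lemma hausdorff_content_cantor_le (R : realType) (s : R) : 0 <= s <= 1 / 2 ->
  ((1 / 2)%:E <= hausdorff_content s 1 (base4_cantor R))%E.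
Proof.
move=> sI; apply: le_ereal_inf_tmp => _ [U [KU U1] <-].
have [J HJ] := choice (fun i => same_bits_cover_itv sI (U1 i)).
have cover : `[0, 1] `<=` \bigcup_i [set` J i].
  move=> t /=; rewrite in_itv/= => /same_bits_surj[x Kx xt].
  have [i _ Ux] := KU x Kx; exists i => //=; by have [_ /(_ x t Ux xt)] := HJ i.
have L : (lebesgue_measure (`[0%R, 1%R]%classic : set R) <=
    \sum_(0 <= i <oo) lebesgue_measure [set` J i])%E.
  by apply: measure_sigma_subadditive.
have {L} := le_trans L (lee_nneseries (fun i _ _ => measure_ge0 _ _) (fun i _ => (HJ i).1)).
rewrite nneseriesZl; last by move=> i _; exact: diam_power_ge0.
rewrite lebesgue_measure_itv/= lte01 oppr0 adde0 => L.
rewrite -(@lee_pmul2l _ 2%:E)// -EFinM (_ : 2 * (1 / 2) = 1)//.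
by field.
Qed.

Lemma hausdorff_dim_cantor (R : realType) :
  hausdorff_dim (base4_cantor R) = (1 / 2)%:E.
Proof.
apply/eqP; rewrite eq_le; apply/andP; split.
  apply/lee_addgt0Pr => eps eps0; rewrite -EFinD.
  apply: ereal_inf_lbound; exists (1 / 2 + eps) => //; split; first by lra.
  by apply: hausdorff_measure_cantor_gt; lra.
(* For s < 1/2 a null measure would force the content at scale 1 to vanish, but that content is at
   least 1/2. *)
apply: le_ereal_inf_tmp => _ [s [s0 Hs] <-]; rewrite lee_fin leNgt; apply/negP => s2.
have : (hausdorff_content s 1 (base4_cantor R) <= 0)%E.
  by rewrite -Hs; apply: ereal_sup_ubound; exists 1 => //; exact: ltr01.
have /le_trans/[apply] := @hausdorff_content_cantor_le R s ltac:(lra).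
by rewrite lee_fin; lra.
Qed.

(** * The three ranges of v combined *)

Theorem theorem11 (R : realType) :
  (forall v : R, - (1 / 2) < v < 1 ->
     is_minimum (takagi v) `[0, 1] 0 /\
     minimizers (takagi v) `[0, 1] = [set 0; 1]) /\
  (forall v : R, v = - (1 / 2) ->
     [/\ hausdorff_dim (minimizers (takagi v) `[0, 1]) = (1 / 2)%:E,
         minimizers (takagi v) `[0, 1] =
           [set x | exists d : nat -> nat, is_expansion 2 d x /\
              forall k : nat, (d k.*2 = 0%N /\ d k.*2.+1 = 0%N) \/
                              (d k.*2 = 1%N /\ d k.*2.+1 = 1%N)],
         minimizers (takagi v) `[0, 1] =
           [set x | exists y : nat -> nat, is_expansion 4 y x /\
              forall k : nat, y k = 0%N \/ y k = 3%N] &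
         is_minimum (takagi v) `[0, 1] 0]) /\
  (forall v : R, - 1 < v < - (1 / 2) ->
     [/\ minimizers (takagi v) `[0, 1] = [set 1 / 5; 4 / 5],
         is_minimum (takagi v) `[0, 1] (takagi v (1 / 5)) &
         takagi v (1 / 5) = (1 + 2 * v) / (5 * (1 - v ^+ 2))]).
Proof.
split; [|split] => v.
- move=> vI; have v1 : `|v| < 1 by rewrite ltr_norml; lra.
  have := @minimizers_takagi R v 0 0; rewrite subr0; apply.
  + by lra.
  + exact: takagi0.
  + by apply: takagi_ge0; lra.
  + by move=> r; exact: takagi_eq0.
- move=> ->; have v1 : `|- (1 / 2) : R| < 1 by rewrite ltr_norml; lra.
  have min : is_minimum (takagi (- (1 / 2))) `[0, 1] (0 : R).
    apply: (is_minimumI (a := 0)); first by rewrite /= in_itv/=; lra.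
      exact: takagi0.
    by move=> x _; apply: takagi_ge0; lra.
  have E : minimizers (takagi (- (1 / 2))) `[0, 1] = base4_cantor R.
    rewrite (minimizersE min) -takagi_half_eq0.
    by apply/seteqP; split=> x /=; rewrite in_itv.
  rewrite E; split=> //.
  + exact: hausdorff_dim_cantor.
  + exact: base4_cantor_expansion2.
  + exact: base4_cantor_expansion4.
- move=> vI; have v1 := norm_lt1_outside_half vI.
  have sI : 0 <= (1 / 5 : R) <= 1 / 2 by lra.
  have [min minE] := minimizers_takagi sI erefl (takagi_ge_fifth vI)
    (fun r => takagi_eq_fifth vI (s := r)).
  split=> //; first by rewrite minE; congr [set _; _]; field.
  have q1 := sqr_norm_lt1 v1.
  apply: (@mulfI _ (1 - v ^+ 2)); first by apply/eqP; lra.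
  by rewrite takagi_fifth//; field; apply/eqP; lra.
Qed.
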